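(* Let $D>0$, $L\in\mathbb{N}$, and let $\mathcal{R}^1=\mathcal{Q}^1\mathcal{K}^1,\dots,\mathcal{R}^{2^L}=\mathcal{Q}^{2^L}\mathcal{K}^{2^L}$ be RNNs with $\mathcal{M}_{\mathrm{in}}(\mathcal{R}^{\ell+1})=\mathcal{M}_{\mathrm{out}}(\mathcal{R}^\ell)$ for $\ell\in\{1,\dots,2^L-1\}$. Assume that there are constants $D_1,\dots,D_{2^L}>0$ and $D_h>0$ with $\max\{2,\max_{\ell\in\{1,\dots,2^L\}}D_\ell\}\le D_h$ such that, for all $\ell\in\{1,\dots,2^L\}$, $$\sup_{\|x\|_\infty\le D_{\ell-1},\,t\in\mathbb{N}_0}\|(\mathcal{R}^\ell\mathcal{D}x)[t]\|_\infty\le D_\ell,\qquad\sup_{\|x\|_\infty\le D_{\ell-1},\,t\in\mathbb{N}_0}\|(\mathcal{K}^\ell\mathcal{D}x)[t]\|_\infty\le D_h,$$ where $D_0=D$. For $\ell\in\{1,\dots,2^L\}$ and $k\ge2$, define the mappings $g_\ell^k:\mathbb{R}^{\mathcal{M}_{\mathrm{in}}(\mathcal{R}^\ell)}\to\mathbb{R}^{\mathcal{M}_{\mathrm{out}}(\mathcal{R}^\ell)}$ by $g_\ell^k(x)=(\mathcal{R}^\ell\mathcal{D}x)[2^k-2]$. Then there exists an RNN $\widehat{\mathcal{R}}^L=\widehat{\mathcal{Q}}^L\widehat{\mathcal{K}}^L$ such that $$\sup_{\|x\|_\infty\le D,\,t\in\mathbb{N}_0}\|(\widehat{\mathcal{R}}^L\mathcal{D}x)[t]\|_\infty\le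 D_{2^L},\qquad\sup_{\|x\|_\infty\le D,\,t\in\mathbb{N}_0}\|(\widehat{\mathcal{K}}^L\mathcal{D}x)[t]\|_\infty\le D_h,$$ and $$(\widehat{\mathcal{R}}^L\mathcal{D}x)[2^k-2]=\left(g_{2^L}^{k-L}\circ\dots\circ g_1^{k-L}\right)(x)\quad\text{for all }k\ge L+2,\ x\in[-D,D]^{\mathcal{M}_{\mathrm{in}}(\mathcal{R}^1)}.$$ Furthermore, for every $\ell\in\{1,\dots,2^L\}$, there are a matrix $A^\ell$, a vector $b^\ell$, and $\widetilde{k}_1,\dots,\widetilde{k}_\ell\in\{0,\dots,\lceil\log(\ell)\rceil\}$ such that $$A^\ell(\widehat{\mathcal{K}}^L\mathcal{D}x)[2^k-2]+b^\ell=\left(g_\ell^{k-\widetilde{k}_\ell}\circ\dots\circ g_1^{k-\widetilde{k}_1}\right)(x)\quad\text{for all }k\ge L+2,\ x\in[-D,D]^{\mathcal{M}_{\mathrm{in}}(\mathcal{R}^1)}.$$ Finally, $$\mathcal{M}_{\mathrm{hid}}(\widehat{\mathcal{R}}^L)=\sum_{\ell=1}^{2^L}\mathcal{M}_{\mathrm{hid}}(\mathcal{R}^\ell)+2\sum_{\ell=1}^{2^L-1}\mathcal{M}_{\mathrm{out}}(\mathcal{R}^\ell)+5(2^L-1).$$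
   Context: Notation: $\mathbb{N}=\{1,2,\dots\}$, $\mathbb{N}_0=\mathbb{N}\cup\{0\}$; $k$ ranges over integers; $\log$ is the logarithm to base $2$; $(\mathbb{R}^d)^{\mathbb{N}_0}$ is the space of sequences in $\mathbb{R}^d$ indexed by $\mathbb{N}_0$; $\|x\|_\infty=\max_i|x_i|$; $\rho(x)=\max(0,x)$, applied componentwise. RNN: An RNN with input dimension $d\in\mathbb{N}$, output dimension $d'\in\mathbb{N}$ and hidden state size $m\in\mathbb{N}$ is given by weights $A_h\in\mathbb{R}^{m\times m}$, $A_x\in\mathbb{R}^{m\times d}$, $A_o\in\mathbb{R}^{d'\times m}$, $b_h\in\mathbb{R}^m$, $b_o\in\mathbb{R}^{d'}$. The hidden state operator $\mathcal{K}:(\mathbb{R}^d)^{\mathbb{N}_0}\to(\mathbb{R}^m)^{\mathbb{N}_0}$ maps an input sequence $(x[t])_{t\in\mathbb{N}_0}$ to $(\mathcal{K}x)[t]=h[t]$, where $h[-1]=0$ and $h[t]=\rho(A_hh[t-1]+A_xx[t]+b_h)$ for $t\in\mathbb{N}_0$. The output mapping is $\mathcal{Q}(h)=A_oh+b_o$. The associated RNN is $\mathcal{R}=\mathcal{Q}\mathcal{K}$, $(\mathcal{R}x)[t]=\mathcal{Q}((\mathcal{K}x)[t])$. Write $\mathcal{M}_{\mathrm{in}}(\mathcal{R})=d$, $\mathcal{M}_{\mathrm{out}}(\mathcal{R})=d'$, $\mathcal{M}_{\mathrm{hid}}(\mathcal{R})=m$. The operator $\mathcal{D}:\mathbb{R}^d\to(\mathbb{R}^d)^{\mathbb{N}_0}$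 is defined by $(\mathcal{D}x)[0]=x$ and $(\mathcal{D}x)[t]=0$ for $t\ge1$. *)

(* Defs.v *)
From HB Require Import structures.
From mathcomp Require Import all_boot all_order all_algebra.
From mathcomp Require Import all_classical all_reals all_analysis.

Set Implicit Arguments.
Unset Strict Implicit.
Unset Printing Implicit Defensive.

Import Order.TTheory GRing.Theory Num.Theory.
Import numFieldNormedType.Exports.

Local Open Scope classical_set_scope.
Local Open Scope ring_scope.

(* Vectors are column vectors; the library norm `|x| on 'cV[R]_d is the
   maximum norm. *)

Definition relu (R : realType) (n : nat) (x : 'cV[R]_n) : 'cV[R]_n :=
  map_mx (fun a : R => Num.max 0 a) x.

(* The input, output and hidden dimensions M_in, M_out, M_hid are the indices
   d, d', m of the type. *)
Record rnn (R : realType) (d d' m : nat) := RNN {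
  A_h : 'M[R]_(m, m);
  A_x : 'M[R]_(m, d);
  A_o : 'M[R]_(d', m);
  b_h : 'cV[R]_m;
  b_o : 'cV[R]_d'
}.

(* The hidden state operator K; the state before time 0 is 0. *)
Fixpoint hidden (R : realType) (d d' m : nat) (N : rnn R d d' m)
    (x : nat -> 'cV[R]_d) (t : nat) : 'cV[R]_m :=
  let h := if t is t'.+1 then hidden N x t' else 0 in
  relu (A_h N *m h + A_x N *m x t + b_h N).

Definition readout (R : realType) (d d' m : nat) (N : rnn R d d' m)
    (h : 'cV[R]_m) : 'cV[R]_d' :=
  A_o N *m h + b_o N.

Definition output (R : realType) (d d' m : nat) (N : rnn R d d' m)
    (x : nat -> 'cV[R]_d) (t : nat) : 'cV[R]_d' :=
  readout N (hidden N x t).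

(* The operator written as a calligraphic D in the mathematics. *)
Definition impulse (R : realType) (d : nat) (x : 'cV[R]_d) : nat -> 'cV[R]_d :=
  fun t => if t is 0%N then x else 0.

(* The supremum of `|F x t| over `|x| <= B and t in N_0, in the extended
   reals, so that it is meaningful without a boundedness proviso. *)
Definition sup_norm (R : realType) (d n : nat) (B : R)
    (F : 'cV[R]_d -> nat -> 'cV[R]_n) : \bar R :=
  ereal_sup [set (`|F x t|)%:E | x in [set x : 'cV[R]_d | `|x| <= B]
                               & t in [set: nat]].

(* The truncated subtraction in 2 ^ k - 2 is harmless for k >= 1. *)
Definition g (R : realType) (d d' m : nat) (N : rnn R d d' m) (k : nat)
    (x : 'cV[R]_d) : 'cV[R]_d' :=
  output N (impulse x) (2 ^ k - 2).

(* A chain of networks is numbered from 1, the l-th one mapping dimension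
   d (l - 1) to dimension d l; the entry N 0 is never used.  The value is
   g_n^{k n} o ... o g_1^{k 1}. *)
Fixpoint gcomp (R : realType) (d m : nat -> nat)
    (N : forall l : nat, rnn R (d l.-1) (d l) (m l)) (k : nat -> nat)
    (n : nat) : 'cV[R]_(d 0%N) -> 'cV[R]_(d n) :=
  match n with
  | 0 => fun x => x
  | n'.+1 => fun x => g (N n'.+1) (k n'.+1) (gcomp N k n' x)
  end.

(* up_log 2 l is the ceiling of the base 2 logarithm of l. *)
Lemma up_log2E (R : realType) (l : nat) : (0 < l)%N ->
  (up_log 2 l)%:Z = Num.ceil (ln (l%:R : R) / ln 2).
Proof.
move=> l0; have ln2 : 0 < ln 2 :> R by rewrite ln_gt0 // ltr1n.
have lnX n : ln ((2 ^ n)%:R : R) = n%:R * ln 2.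
  by rewrite natrX lnXn // mulr_natl.
have [->|l1] := eqVneq l 1%N; first by rewrite up_log1 ln1 mul0r ceil0.
have lgt1 : (1 < l)%N by rewrite ltn_neqAle eq_sym l1.
have /andP[lo hi] := up_log_bounds (isT : (1 < 2)%N) lgt1.
have up0 : (0 < up_log 2 l)%N by rewrite up_log_gt0.
apply/esym/ceil_def/andP; split.
- rewrite ltr_pdivlMr // -[X in X%:Z](prednK up0).
  rewrite (_ : (_ - 1)%:~R = (up_log 2 l).-1%:R :> R); last first.
    by rewrite -addn1 PoszD addrK.
  by rewrite -lnX ltr_ln ?posrE ?ltr0n ?expn_gt0 // ltr_nat.
- rewrite ler_pdivrMr // -pmulrn -lnX ler_ln ?posrE ?ltr0n ?expn_gt0 //.
  by rewrite ler_nat.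
Qed.

(* Main.v *)
Require Import Defs.
From HB Require Import structures.
From mathcomp Require Import all_boot all_order all_algebra.
From mathcomp Require Import all_classical all_reals all_analysis.
From mathcomp Require Import ring lra zify.

Set Implicit Arguments.
Unset Strict Implicit.
Unset Printing Implicit Defensive.

Import Order.TTheory GRing.Theory Num.Theory.
Import numFieldNormedType.Exports.

Local Open Scope classical_set_scope.
Local Open Scope ring_scope.

(* Two networks are composed by letting the first run undisturbed while the
   second is restarted at every time 2^j, on the output the first one had at
   time 2^j - 2.  At time 2^(j+1) - 2 the second network has then run for
   2^j - 2 steps, so that g^(k-1) o g^(k-1) is read off at time 2^k - 2.  The
   restart times come from a clock, an autonomous network of 6 neurons with
   doubling periods.  Storing the transmitted vector of dimension d with an
   offset takes d neurons; the 2 d + 5 neurons available for each composition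
   thus leave d - 1 >= 0 idle.  Composing pairwise along a binary tree gives the
   result, each of its L levels costing one unit of k. *)

(** * Maximum-norm bounds and the rectifier *)

Lemma cV_norm_leP (R : realType) (n : nat) (x : 'cV[R]_n) (B : R) : 0 <= B ->
  reflect (forall i, `|x i ord0| <= B) (`|x| <= B).
Proof.
move=> B0; rewrite [`|x|]mx_normrE; apply: (iffP (bigmax_leP _ _ _ _)).
  by move=> [_ H] i; apply: (H (i, ord0)).
by move=> H; split=> // -[i j] _ /=; rewrite (ord1 j).
Qed.

Lemma cV_norm_le_itv (R : realType) (n : nat) (x : 'cV[R]_n) (B : R) : 0 <= B ->
  (forall i, x i ord0 \in `[- B, B]) -> `|x| <= B.
Proof.
move=> B0 H; apply/(cV_norm_leP x B0) => i.
by rewrite ler_norml; apply: H. Qed.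

Lemma col_mx_norm_le (R : realType) (n1 n2 : nat) (x : 'cV[R]_n1)
    (y : 'cV[R]_n2) (B : R) : 0 <= B ->
  `|x| <= B -> `|y| <= B -> `|col_mx x y| <= B.
Proof.
move=> B0 /(cV_norm_leP _ B0) hx /(cV_norm_leP _ B0) hy.
apply/(cV_norm_leP _ B0) => i.
by rewrite mxE; case: (splitP i) => j _.
Qed.

Lemma sup_norm_leP (R : realType) (d n : nat) (B C : R)
    (F : 'cV[R]_d -> nat -> 'cV[R]_n) :
  (sup_norm B F <= C%:E)%E <-> forall x t, `|x| <= B -> `|F x t| <= C.
Proof.
split=> [H x t hx | H].
  rewrite -lee_fin; apply: le_trans H; apply: ereal_sup_ubound.
  by exists x => //; exists t.
by apply: ge_ereal_sup => _ [x hx [t _ <-]]; rewrite lee_fin; apply: H.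
Qed.

Lemma relu_col_mx (R : realType) (n1 n2 : nat) (x : 'cV[R]_n1) (y : 'cV[R]_n2) :
  relu (col_mx x y) = col_mx (relu x) (relu y).
Proof. exact: map_col_mx. Qed.

Lemma relu_le0 (R : realType) (n : nat) (x : 'cV[R]_n) :
  (forall i, x i ord0 <= 0) -> relu x = 0.
Proof. by move=> H; apply/colP => i; rewrite !mxE max_l. Qed.

Lemma relu_ge0 (R : realType) (n : nat) (x : 'cV[R]_n) :
  (forall i, 0 <= x i ord0) -> relu x = x.
Proof. by move=> H; apply/colP => i; rewrite !mxE max_r. Qed.

(** A bound on a state thus bounds its preactivations from above, which makes subtracting [Dh]
    enough to reset a network. *)
Lemma relu_le_norm (R : realType) (n : nat) (x : 'cV[R]_n) i :
  x i ord0 <= `|relu x|.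
Proof.
have /(cV_norm_leP _ (normr_ge0 _)) /(_ i) := lexx `|relu x|.
by apply: le_trans; rewrite mxE (le_trans _ (ler_norm _)) // le_max lexx orbT.
Qed.

(** * The clock *)

(* Entry [(j, i)] describes time [2 ^ j - 2 + i]. *)
Lemma dyadic_ind (P : nat -> nat -> Prop) :
  P 2%N 0%N ->
  (forall j i, (2 <= j)%N -> (i.+1 < 2 ^ j)%N -> P j i -> P j i.+1) ->
  (forall j, (2 <= j)%N -> P j (2 ^ j).-1 -> P j.+1 0%N) ->
  forall j i, (2 <= j)%N -> (i < 2 ^ j)%N -> P j i.
Proof.
move=> P0 PS Pj j i; elim: j i => // j IHj i j2.
have Pj0 : P j.+1 0%N.
  move: j2; rewrite leq_eqVlt eqSS => /orP[/eqP <- // | j2].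
  by apply: Pj => //; apply: IHj => //; rewrite prednK // expn_gt0.
by elim: i => // i IHi lti; apply: PS => //; apply: IHi; apply: ltnW.
Qed.

(** Take for [2 ^ j] the largest power of two not exceeding [t + 2]; from time 2 on, this gives
    [j >= 2]. *)
Lemma dyadic_split t : (2 <= t)%N ->
  exists j i, [/\ (2 <= j)%N, (i < 2 ^ j)%N & t = (2 ^ j - 2 + i)%N].
Proof.
move=> t2;
have /andP[lo hi] :=
  trunc_log_bounds (isT : (1 < 2)%N) (isT : (0 < t.+2)%N).
have j2 : (2 <= trunc_log 2 t.+2)%N by apply: trunc_log_max.
exists (trunc_log 2 t.+2), (t.+2 - 2 ^ trunc_log 2 t.+2)%N.
have : (2 ^ 2 <= 2 ^ trunc_log 2 t.+2)%N by rewrite leq_exp2l.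
by move: hi; rewrite expnS; split=> //; lia.
Qed.

(** Entries past the end of the list default to 0, so the [n] idle neurons need not be listed. *)
Definition seq_cV (R : realType) (n : nat) (s : seq R) : 'cV[R]_n :=
  \col_i s`_i.

Definition table_mx (R : realType) (m n : nat) (T : seq (seq R)) :
    'M[R]_(m, n) := \matrix_(i, j) (nth [::] T i)`_j.

Lemma table_mx_mul (R : realType) (m n : nat) T (s : seq R) : (size s <= n)%N ->
  table_mx m n T *m seq_cV n s =
  seq_cV m [seq \sum_(0 <= j < size s) r`_j * s`_j | r <- T].
Proof.
move=> sn; apply/colP => i; rewrite !mxE.
under eq_bigr do rewrite !mxE.
rewrite -(big_mkord xpredT (fun j => (nth [::] T i)`_j * s`_j)).
rewrite (big_cat_nat (leq0n _) sn) /= [X in _ + X]big_nat_cond.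
rewrite [X in _ + X]big1 ?addr0; last first.
  by move=> j /andP[/andP[sj _] _]; rewrite [s`_j]nth_default ?mulr0.
case: (ltnP i (size T)) => iT; first by rewrite (nth_map [::]).
rewrite !nth_default ?size_map // big1 // => j _.
by rewrite nth_nil mul0r.
Qed.

(* Neurons [s, G, O, a, b, v].  Between two pulses of [G] the counter [a + b]
   doubles at every step, and [G] fires when it reaches 1; meanwhile [v] is
   divided by 4, so that when loaded into [b] at the pulse it makes the next
   period twice as long.  [O] is [G] delayed by one step, and the constant [s]
   vanishes only before time 0, which starts the counters. *)
Definition clock_mx (R : realType) (n : nat) : 'M[R]_(6 + n) := table_mx _ _
  [:: [::];
      [:: 0; -4; 0; 4; 4];
      [:: 0; 1];
      [:: - 4^-1; -2; 0; 2; 2];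
      [:: 0; 2; 0; 0; 0; 1];
      [:: -2; -1; 8^-1; 0; 0; 4^-1]].

Definition clock_bias (R : realType) (n : nat) : 'cV[R]_(6 + n) :=
  seq_cV _ [:: 1; -1; 0; 4^-1; -2; 2].

Definition clock_step (R : realType) (n : nat)
    (h : 'cV[R]_(6 + n)) : 'cV[R]_(6 + n) :=
  relu (clock_mx R n *m h + clock_bias R n).

Definition clock (R : realType) (n : nat) (t : nat) : 'cV[R]_(6 + n) :=
  iter t.+1 (@clock_step R n) 0.

Definition pulse_row (R : realType) (n : nat) : 'rV[R]_(6 + n) :=
  table_mx _ _ [:: [:: 0; 1]].

Definition late_pulse_row (R : realType) (n : nat) : 'rV[R]_(6 + n) :=
  table_mx _ _ [:: [:: 0; 0; 1]].

Lemma clock_stepE (R : realType) (n : nat) (s G O a b v : R) :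
  clock_step (seq_cV (6 + n) [:: s; G; O; a; b; v]) =
  seq_cV _ [:: 1; Num.max 0 (4 * (a + b) - 1 - 4 * G); Num.max 0 G;
               Num.max 0 (2 * (a + b) - 2 * G + (1 - s) / 4);
               Num.max 0 (v - 2 * (1 - G));
               Num.max 0 (v / 4 - G + O / 8 + 2 * (1 - s))].
Proof.
rewrite /clock_step table_mx_mul //; apply/colP => i; rewrite !mxE /=.
case: (nat_of_ord i) => [|[|[|[|[|[|k]]]]]] /=;
  rewrite ?big_nat_recl ?big_geq //= ?nth_nil.
- by rewrite max_r ?addr0; lra.
1-5: by congr Num.max; field.
by rewrite add0r max_l.
Qed.

(** The counter starts the period from [2 ^- (2 ^ j).-1], in [b] at [i = 1]. Meanwhile [v] restarts
    from 1/8 at [i = 2]; divided by 4 at each step, it reaches the starting value of the next period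
    exactly at the next pulse. *)
Definition clock_state (R : realType) (n : nat) (j i : nat) : 'cV[R]_(6 + n) :=
  seq_cV _ match i with
  | 0 => [:: 1; 1; 0; 1; 0; 2 ^- (2 ^ j).-1]
  | 1 => [:: 1; 0; 1; 0; 2 ^- (2 ^ j).-1; 0]
  | _ => [:: 1; 0; 0; 2 ^- (2 ^ j - i); 0; 2 ^- (2 * i).-1]
  end.

(** With these values of [a] and [v] the first pulse comes at time [2 = 2 ^ 2 - 2], and [v] is then
    1/8, the starting value for a period of length 4. *)
Lemma clock0 (R : realType) n : clock R n 0 = seq_cV _ [:: 1; 0; 0; 4^-1; 0; 2].
Proof.
rewrite /clock /= /clock_step mulmx0 add0r; apply/colP => i; rewrite !mxE.
case: (nat_of_ord i) => [|[|[|[|[|[|k]]]]]] /=; rewrite ?nth_nil;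
  solve [rewrite max_r //; lra | rewrite max_l //; lra].
Qed.

Lemma clock1 (R : realType) n : clock R n 1 =
  seq_cV _ [:: 1; 0; 0; 2^-1; 0; 2^-1].
Proof.
have -> : clock R n 1 = clock_step (clock R n 0) by [].
rewrite clock0 clock_stepE; congr seq_cV.
by congr [:: _; _; _; _; _; _]; rewrite maxElt; case: ltP => //; lra.
Qed.

Lemma clockS (R : realType) n t : clock R n t.+1 = clock_step (clock R n t).
Proof. by []. Qed.

Lemma exp2_gt0 (R : realType) n : 0 < 2 ^- n :> R.
Proof. by rewrite invr_gt0 exprn_gt0. Qed.

Lemma exp2S (R : realType) n : 2 ^- n.+1 = 2 ^- n / 2 :> R.
Proof. by rewrite exprS invfM mulrC. Qed.

Lemma exp2_le1 (R : realType) n : 2 ^- n <= 1 :> R.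
Proof. by rewrite invf_le1 ?exprn_gt0 // exprn_ege1 // ler1n. Qed.

Lemma clock_dyadic (R : realType) n j i : (2 <= j)%N -> (i < 2 ^ j)%N ->
  clock R n (2 ^ j - 2 + i) = clock_state R n j i.
Proof.
move: j i; apply: dyadic_ind => [|j i j2 ij|j j2].
- rewrite addn0 clockS clock1 clock_stepE; congr seq_cV.
  have -> : (2 ^ 2).-1 = 3%N by [].
  rewrite !exp2S expr0.
  by congr [:: _; _; _; _; _; _]; rewrite maxElt; case: ltP => //; lra.
- rewrite addnS clockS => ->; case: i ij => [|[|i]] ij.
  + have e0 := exp2_gt0 R (2 ^ j).-1; have e1 := exp2_le1 R (2 ^ j).-1.
    rewrite clock_stepE; congr seq_cV.
    by congr [:: _; _; _; _; _; _]; rewrite maxElt; case: ltP => //; lra.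
  (* With the exponents in successor form, [exp2S] expresses all powers through a single one, and
     the comparisons become linear. *)
  + have [p Ep] : exists p, (2 ^ j)%N = p.+4.
      have : (2 ^ 2 <= 2 ^ j)%N by rewrite leq_exp2l.
      by exists (2 ^ j - 4)%N; lia.
    rewrite clock_stepE; congr seq_cV; rewrite Ep /= !subSS subn0.
    rewrite !exp2S expr0.
    have e0 := exp2_gt0 R p; have e1 := exp2_le1 R p.
    by congr [:: _; _; _; _; _; _]; rewrite maxElt; case: ltP => //; lra.
  + have [p Ep] : exists p, (2 ^ j - i.+3)%N = p.+1.
      by exists (2 ^ j - i.+4)%N; lia.
    rewrite clock_stepE; congr seq_cV; rewrite Ep.
    have -> : (2 ^ j - i.+2 = p.+2)%N by lia.
    have -> : ((2 * i.+3).-1 = (2 * i.+2).-1.+2)%N by lia.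
    move: (2 * i.+2).-1 => q; rewrite !exp2S.
    have e0 := exp2_gt0 R p; have e1 := exp2_le1 R p.
    have f0 := exp2_gt0 R q; have f1 := exp2_le1 R q.
    by congr [:: _; _; _; _; _; _]; rewrite maxElt; case: ltP => //; lra.
- have j4 : (2 ^ 2 <= 2 ^ j)%N by rewrite leq_exp2l.
  have -> : (2 ^ j.+1 - 2 + 0 = (2 ^ j - 2 + (2 ^ j).-1).+1)%N.
    by rewrite expnS; lia.
  rewrite clockS => ->.
  have [p Ep] : exists p, (2 ^ j).-1 = p.+2 by exists (2 ^ j - 3)%N; lia.
  rewrite Ep [clock_state _ _ _ p.+2]/clock_state clock_stepE; congr seq_cV.
  (* In the last step of the period the counter stands at 1/2, so that [G] becomes
     [4 / 2 - 1 = 1]. *)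
  have -> : (2 ^ j - p.+2 = 1)%N by lia.
  have -> : ((2 ^ j.+1).-1 = (2 * p.+2).-1.+2)%N by rewrite expnS; lia.
  move: (2 * p.+2).-1 => q; rewrite !exp2S expr0.
  have f0 := exp2_gt0 R q; have f1 := exp2_le1 R q.
  by congr [:: _; _; _; _; _; _]; rewrite maxElt; case: ltP => //; lra.
Qed.

Lemma table_row_mul (R : realType) n (r s : seq R) : (size s <= n)%N ->
  table_mx 1 n [:: r] *m seq_cV n s = (\sum_(0 <= j < size s) r`_j * s`_j)%:M.
Proof.
by move=> sn; rewrite table_mx_mul //; apply/colP => i; rewrite !ord1 !mxE.
Qed.

Lemma clock_pulse_early (R : realType) n t : (t < 2)%N ->
  pulse_row R n *m clock R n t = 0 /\ late_pulse_row R n *m clock R n t = 0.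
Proof.
case: t => [|[|//]] _; rewrite (clock0, clock1) !table_row_mul //=;
  by split; apply/colP => i; rewrite !ord1 !mxE mulr1n !big_nat_recl // big_geq //= ?nth_nil; lra.
Qed.

Lemma clock_pulse (R : realType) n j i : (2 <= j)%N -> (i < 2 ^ j)%N ->
  pulse_row R n *m clock R n (2 ^ j - 2 + i) = (i == 0)%:R%:M /\
  late_pulse_row R n *m clock R n (2 ^ j - 2 + i) = (i == 1)%:R%:M.
Proof.
move=> j2 ij; rewrite clock_dyadic //; case: i ij => [|[|i]] _;
  by rewrite !table_row_mul //= !big_nat_recl // big_geq //= ?nth_nil; split; congr _%:M; lra.
Qed.

Lemma seq_cV_norm_le (R : realType) n (s : seq R) (B : R) : 0 <= B ->
  all (fun a => `|a| <= B) s -> `|seq_cV n s| <= B.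
Proof.
move=> B0 /all_nthP H; apply/(cV_norm_leP _ B0) => i; rewrite mxE.
case: (ltnP i (size s)) => si; first exact: H.
by rewrite nth_default // normr0.
Qed.

(** The value 2 is taken by [v] at time 0. This bound is where [2 <= Dh] enters. *)
Lemma clock_norm (R : realType) n t : `|clock R n t| <= 2.
Proof.
have E k : `|2 ^- k : R| <= 2.
  by have e0 := exp2_gt0 R k; have e1 := exp2_le1 R k; rewrite ger0_norm; lra.
case: (ltnP t 2) => [|/dyadic_split[j [i [j2 ij ->]]]].
  case: t => [|[|//]] _; rewrite (clock0, clock1); apply: seq_cV_norm_le => //=;
    by rewrite !ger0_norm; lra.
rewrite clock_dyadic //; case: i ij => [|[|i]] _; apply: seq_cV_norm_le => //=;
  by rewrite !E ?normr0 ?normr1 ?ler1n ?ler0n.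
Qed.

(** * Composition of two networks *)

(* Hidden blocks: the hidden state of [N1], that of [N2], a buffer [y] and the
   clock.  At a pulse the output [u] of [N1] is written to the buffer in the
   form [(u + B) / 2], which lies in [[0, B]], while [N2] is reset to 0; one
   step later [N2] reads [2 y - B = u].  At that step, when the state of [N2]
   is 0, its bias is removed from the output, since [b_o N2] need not obey the
   bound on the outputs of [N2]. *)
Definition compose (R : realType) (d1 d2 d3 m1 m2 n : nat)
    (N1 : rnn R d1 d2 m1) (N2 : rnn R d2 d3 m2) (B Dh : R) :
    rnn R d1 d3 (m1 + (m2 + (d2 + (6 + n)))) :=
  let M := B + `|b_o N1| in
  let G := pulse_row R n in
  let O := late_pulse_row R n in
  {| A_h :=
       col_mx (row_mx (A_h N1) 0)
      (col_mx (row_mx 0 (row_mx (A_h N2) (row_mx (2 *: A_x N2)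
         (- (Dh *: (const_mx 1 *m G)) - B *: (A_x N2 *m (const_mx 1 *m O))))))
      (col_mx (row_mx (2^-1 *: A_o N1)
                 (row_mx 0 (row_mx 0 (M *: (const_mx 1 *m G)))))
              (row_mx 0 (row_mx 0 (row_mx 0 (clock_mx R n))))));
     A_x := col_mx (A_x N1) 0;
     A_o := row_mx 0 (row_mx (A_o N2) (row_mx 0 (- (b_o N2 *m O))));
     b_h := col_mx (b_h N1) (col_mx (b_h N2)
              (col_mx (2^-1 *: b_o N1 + const_mx (2^-1 * B - M))
                      (clock_bias R n)));
     b_o := b_o N2 |}.

(** * One step of the composed network, phase by phase *)

Definition step (R : realType) (d d' m : nat) (N : rnn R d d' m)
    (h : 'cV[R]_m) (x : 'cV[R]_d) : 'cV[R]_m :=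
  relu (A_h N *m h + A_x N *m x + b_h N).

Lemma hidden_impulse0 (R : realType) (d d' m : nat) (N : rnn R d d' m) x :
  hidden N (impulse x) 0 = step N 0 x.
Proof. by []. Qed.

Lemma hidden_impulseS (R : realType) (d d' m : nat) (N : rnn R d d' m) x t :
  hidden N (impulse x) t.+1 = step N (hidden N (impulse x) t) 0.
Proof. by []. Qed.

Lemma compose_step (R : realType) (d1 d2 d3 m1 m2 n : nat)
    (N1 : rnn R d1 d2 m1) (N2 : rnn R d2 d3 m2) (B Dh : R)
    h1 h2 y c x (g o : R) :
  pulse_row R n *m c = g%:M -> late_pulse_row R n *m c = o%:M ->
  step (compose n N1 N2 B Dh) (col_mx h1 (col_mx h2 (col_mx y c))) x =
  col_mx (step N1 h1 x)
    (col_mx (relu (A_h N2 *m h2 + A_x N2 *m (2 *: y - const_mx (B * o)) + b_h N2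
                   - const_mx (Dh * g)))
       (col_mx (relu (2^-1 *: readout N1 h1
                  + const_mx (2^-1 * B - (B + `|b_o N1|) * (1 - g))))
               (clock_step c))).
Proof.
move=> hg ho; rewrite /step /=.
rewrite !mul_col_mx !mul_row_col !mul0mx !add0r !(add_col_mx, addr0) !relu_col_mx.
have E k (a : R) : const_mx 1 *m a%:M = const_mx a :> 'cV[R]_k.
  by rewrite mul_mx_scalar; apply/colP => i; rewrite !mxE mulr1.
congr col_mx; congr col_mx; [|congr col_mx].
- congr relu; rewrite mulmxDl !mulNmx -!scalemxAl -!mulmxA hg ho !E.
  apply/colP => i; rewrite mulmxDr mulmxN.
  have -> : const_mx (B * o) = B *: const_mx o :> 'cV[R]_d2.
    by apply/colP => k; rewrite !mxE.
  by rewrite -!scalemxAr !mxE; ring.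
- congr relu; rewrite -!scalemxAl -mulmxA hg E /readout.
  by apply/colP => i; rewrite !mxE; ring.
Qed.

Lemma compose_readout (R : realType) (d1 d2 d3 m1 m2 n : nat)
    (N1 : rnn R d1 d2 m1) (N2 : rnn R d2 d3 m2) (B Dh : R) h1 h2 y c (o : R) :
  late_pulse_row R n *m c = o%:M ->
  readout (compose n N1 N2 B Dh) (col_mx h1 (col_mx h2 (col_mx y c))) =
  A_o N2 *m h2 + (1 - o) *: b_o N2.
Proof.
move=> ho; rewrite /readout /= !mul_row_col !mul0mx !add0r mulNmx -mulmxA ho.
by rewrite mul_mx_scalar -addrA scalerBl scale1r [- _ + _]addrC.
Qed.

Lemma step_idle (R : realType) (d d' m : nat) (N : rnn R d d' m) h (B Dh : R) :
  relu (A_h N *m h + A_x N *m (2 *: 0 - const_mx (B * 0)) + b_h N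
        - const_mx (Dh * 0)) = step N h 0.
Proof.
have E k : const_mx 0 = 0 :> 'cV[R]_k by apply/colP => i; rewrite !mxE.
by rewrite !mulr0 !E scaler0 !subr0.
Qed.

(** The undisturbed step would stay within [Dh], so its preactivations are at most [Dh] and become
    nonpositive after the subtraction. *)
Lemma step_reset (R : realType) (d d' m : nat) (N : rnn R d d' m) h (B Dh : R) :
  `|step N h 0| <= Dh ->
  relu (A_h N *m h + A_x N *m (2 *: 0 - const_mx (B * 0)) + b_h N
        - const_mx (Dh * 1)) = 0.
Proof.
move=> hD; apply: relu_le0 => i.
have E k : const_mx 0 = 0 :> 'cV[R]_k by apply/colP => j; rewrite !mxE.
rewrite mulr0 E scaler0 subr0 mulr1.
have /le_trans/(_ hD) := relu_le_norm (A_h N *m h + A_x N *m 0 + b_h N) i.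
by move: (A_h N *m h + _ + _) => w; rewrite !mxE; lra.
Qed.

Lemma step_load (R : realType) (d d' m : nat) (N : rnn R d d' m) u (B Dh : R) :
  relu (A_h N *m 0 + A_x N *m (2 *: (2^-1 *: u + const_mx (2^-1 * B))
        - const_mx (B * 1)) + b_h N - const_mx (Dh * 0)) = step N 0 u.
Proof.
have E k : const_mx 0 = 0 :> 'cV[R]_k by apply/colP => i; rewrite !mxE.
rewrite mulr0 E subr0; congr (relu (_ + _ *m _ + _)).
by apply/colP => i; rewrite !mxE; field.
Qed.

(** The subtracted [B + |b|] is at least [(u + B) / 2] entrywise. The maximum covers both the
    outputs of the first network, bounded by [B], and its readout of the zero state before time 0,
    which is its bias [b]. *)
Lemma buffer_closed (R : realType) (d : nat) (u b : 'cV[R]_d) (B : R) :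
  `|u| <= Num.max B `|b| -> 0 <= B ->
  relu (2^-1 *: u + const_mx (2^-1 * B - (B + `|b|) * (1 - 0))) = 0.
Proof.
move=> uB B0; apply: relu_le0 => i; rewrite !mxE.
have M0 : 0 <= Num.max B `|b| by rewrite le_max B0.
have /(cV_norm_leP _ M0) /(_ i) := uB.
have : Num.max B `|b| <= B + `|b| by rewrite ge_max lerDl lerDr B0 normr_ge0.
have := normr_ge0 b; rewrite ler_norml => ? ? /andP[_ ?]; lra.
Qed.

Lemma buffer_open (R : realType) (d : nat) (u b : 'cV[R]_d) (B : R) :
  `|u| <= B ->
  relu (2^-1 *: u + const_mx (2^-1 * B - (B + `|b|) * (1 - 1))) =
  2^-1 *: u + const_mx (2^-1 * B).
Proof.
move=> uB; rewrite subrr mulr0 subr0 relu_ge0 // => i; rewrite !mxE.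
have /(cV_norm_leP _ (le_trans (normr_ge0 _) uB)) /(_ i) := uB.
rewrite ler_norml => /andP[? _]; lra.
Qed.

(** Reset and loading take two steps, so a run restarted in a period of length [2 ^ j.-1] has
    reached time [2 ^ j.-1 - 2] at the next pulse. Before the first pulse, at [j = 2], nothing was
    loaded and the run is on zero input. *)
Definition receiver_state (R : realType) (d d' m : nat) (N : rnn R d d' m)
    (u : nat -> 'cV[R]_d) (j i : nat) : 'cV[R]_m :=
  match i with
  | 0 => if j == 2 then hidden N (impulse 0) 2
         else hidden N (impulse (u j.-1)) (2 ^ j.-1 - 2)
  | 1 => 0
  | i'.+2 => hidden N (impulse (u j)) i'
  end.

Definition buffer_state (R : realType) (d : nat) (u : nat -> 'cV[R]_d) (B : R)
    (j i : nat) : 'cV[R]_d :=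
  if i == 1%N then 2^-1 *: u j + const_mx (2^-1 * B) else 0.

(** Except right after a reset, the receiver is thus in a state to which the bounds assumed for [N]
    apply. *)
Lemma receiver_stateP (R : realType) (d d' m : nat) (N : rnn R d d' m)
    (u : nat -> 'cV[R]_d) (B : R) j i :
  (forall k, `|u k| <= B) -> i != 1%N ->
  exists v t, `|v| <= B /\ receiver_state N u j i = hidden N (impulse v) t.
Proof.
move=> uB; case: i => [|[//|i]] _; last by exists (u j), i.
rewrite /receiver_state; case: ifP => _; last by exists (u j.-1), (2 ^ j.-1 - 2)%N.
by exists 0, 2%N; rewrite normr0 (le_trans _ (uB 0%N)).
Qed.

(** The first pulse, at time 2, affects the state only from time 3 on; until then the second network
    runs on zero input. *)
Lemma compose_hidden_early (R : realType) (d1 d2 d3 m1 m2 n : nat)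
    (N1 : rnn R d1 d2 m1) (N2 : rnn R d2 d3 m2) (B1 B Dh : R) x t :
  0 <= B ->
  (forall x t, `|x| <= B1 -> `|output N1 (impulse x) t| <= B) ->
  `|x| <= B1 -> (t <= 2)%N ->
  hidden (compose n N1 N2 B Dh) (impulse x) t =
  col_mx (hidden N1 (impulse x) t) (col_mx (hidden N2 (impulse 0) t)
    (col_mx 0 (clock R n t))).
Proof.
move=> B0 out1 xB.
have S0 : (0 : 'M[R]_1) = 0%:M by rewrite -scalemx1 scale0r.
have Z k (r : 'rV[R]_k) : r *m (0 : 'cV_k) = 0%:M by rewrite mulmx0.
elim: t => [|t IHt] t2.
  rewrite hidden_impulse0 -[0](@col_mx0 R _ _ 1) -[X in col_mx _ X]col_mx0.
  rewrite -[X in col_mx _ (col_mx _ X)]col_mx0.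
  rewrite (compose_step _ _ _ _ _ _ _ _ (Z _ _) (Z _ _)).
  rewrite step_idle buffer_closed //.
  (* Before time 0 the readout of [N1] is [b_o N1], covered by the second term of the maximum. *)
  by rewrite /readout mulmx0 add0r le_max lexx orbT.
rewrite hidden_impulseS IHt ?(ltnW t2) //.
have [] := clock_pulse_early R n t2; rewrite S0 => hg ho.
rewrite (compose_step _ _ _ _ _ _ _ _ hg ho).
by rewrite step_idle buffer_closed // le_max out1.
Qed.

Lemma compose_hidden (R : realType) (d1 d2 d3 m1 m2 n : nat)
    (N1 : rnn R d1 d2 m1) (N2 : rnn R d2 d3 m2) (B1 B Dh : R) x j i :
  0 <= B ->
  (forall x t, `|x| <= B1 -> `|output N1 (impulse x) t| <= B) ->
  (forall x t, `|x| <= B -> `|hidden N2 (impulse x) t| <= Dh) ->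
  `|x| <= B1 -> (2 <= j)%N -> (i < 2 ^ j)%N ->
  let t := (2 ^ j - 2 + i)%N in
  let u k := output N1 (impulse x) (2 ^ k - 2) in
  hidden (compose n N1 N2 B Dh) (impulse x) t =
  col_mx (hidden N1 (impulse x) t) (col_mx (receiver_state N2 u j i)
    (col_mx (buffer_state u B j i) (clock R n t))).
Proof.
move=> B0 out1 hid2 xB j2 ij t u; rewrite {}/t; move: j i j2 ij.
have uB k : `|u k| <= B by apply: out1.
apply: dyadic_ind => [|j i j2 ij IH|j j2 IH].
- by rewrite (compose_hidden_early _ _ _ B0 out1 xB).
- have [hg ho] := clock_pulse R n j2 (ltnW ij).
  rewrite addnS hidden_impulseS IH (compose_step _ _ _ _ _ _ _ _ hg ho).
  congr col_mx; case: i ij {IH hg ho} => [|[|i]] ij.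
  (* The three cases are the phases of a period: reset of the receiver with writing of the buffer,
     loading, and free run. *)
  + have [//|v [r [vB ->]]] := receiver_stateP N2 (i := 0) j uB.
    rewrite addn0 /buffer_state [receiver_state _ _ _ _]/= step_reset; last first.
      by rewrite -hidden_impulseS hid2.
    by rewrite buffer_open //; apply: out1.
  + by rewrite /buffer_state /= step_load buffer_closed // le_max [X in X || _]out1.
  + by rewrite /buffer_state /= step_idle buffer_closed // le_max out1.
- have j4 : (2 ^ 2 <= 2 ^ j)%N by rewrite leq_exp2l.
  have [p Ep] : exists p, (2 ^ j).-1 = p.+2 by exists (2 ^ j - 3)%N; lia.
  have ij : ((2 ^ j).-1 < 2 ^ j)%N by lia.
  have [hg ho] := clock_pulse R n j2 ij.
  have -> : (2 ^ j.+1 - 2 + 0 = (2 ^ j - 2 + (2 ^ j).-1).+1)%N.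
    by rewrite expnS; lia.
  rewrite hidden_impulseS IH (compose_step _ _ _ _ _ _ _ _ hg ho) Ep.
  rewrite /buffer_state /= step_idle buffer_closed //; last first.
    by rewrite le_max out1.
  rewrite ifN_eq; last by apply/eqP => jE; move: j2; rewrite -ltnS jE.
  by have -> : (2 ^ j - 2 = p.+1)%N by lia.
Qed.

Lemma buffer_state_norm (R : realType) (d : nat) (u : nat -> 'cV[R]_d)
    (B : R) j i :
  `|u j| <= B -> `|buffer_state u B j i| <= B.
Proof.
move=> uB; have B0 : 0 <= B := le_trans (normr_ge0 _) uB.
rewrite /buffer_state; case: ifP => _; last by rewrite normr0.
apply/(cV_norm_leP _ B0) => l; rewrite !mxE.
have /(cV_norm_leP _ B0) /(_ l) := uB.
rewrite !ler_norml => /andP[? ?]; lra.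
Qed.

Lemma compose_norm (R : realType) (d1 d2 d3 m1 m2 n : nat)
    (N1 : rnn R d1 d2 m1) (N2 : rnn R d2 d3 m2) (B1 B B3 Dh : R) x t :
  0 <= B -> B <= Dh -> 2 <= Dh -> 0 <= B3 ->
  (forall x t, `|x| <= B1 -> `|output N1 (impulse x) t| <= B) ->
  (forall x t, `|x| <= B1 -> `|hidden N1 (impulse x) t| <= Dh) ->
  (forall x t, `|x| <= B -> `|output N2 (impulse x) t| <= B3) ->
  (forall x t, `|x| <= B -> `|hidden N2 (impulse x) t| <= Dh) ->
  `|x| <= B1 ->
  `|hidden (compose n N1 N2 B Dh) (impulse x) t| <= Dh /\
  `|output (compose n N1 N2 B Dh) (impulse x) t| <= B3.
Proof.
move=> B0 BD D2 B30 out1 hid1 out2 hid2 xB.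
have D0 : 0 <= Dh := le_trans B0 BD.
have clockD s : `|clock R n s| <= Dh := le_trans (clock_norm R n s) D2.
have S0 : (0 : 'M[R]_1) = 0%:M by rewrite -scalemx1 scale0r.
rewrite /output; case: (ltnP t 2) => [t2|/dyadic_split[j [i [j2 ij ->]]]].
  have [_] := clock_pulse_early R n t2; rewrite S0 => ho.
  rewrite (compose_hidden_early _ _ _ B0 out1 xB (ltnW t2)).
  rewrite (compose_readout _ _ _ _ _ _ _ ho) subr0 scale1r; split; last first.
    by apply: out2; rewrite normr0.
  by rewrite !col_mx_norm_le ?hid1 ?hid2 ?normr0.
have [_ ho] := clock_pulse R n j2 ij.
rewrite (compose_hidden n B0 out1 hid2 xB j2 ij).
rewrite (compose_readout _ _ _ _ _ _ _ ho).
set u := fun k => _; have uB k : `|u k| <= B by apply: out1.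
(* At [i = 1] the receiver is 0 and its bias is cancelled, so the output is 0; otherwise the bounds
   on [N2] apply. *)
have [-> | /(receiver_stateP N2 j uB)[v [r [vB ->]]]] := eqVneq i 1%N.
  rewrite [receiver_state _ _ _ _]/= mulmx0 add0r subrr scale0r normr0; split=> //.
  by rewrite !col_mx_norm_le ?hid1 ?normr0 ?(le_trans (buffer_state_norm _ (uB _))).
rewrite subr0 scale1r; split; last exact: out2.
by rewrite !col_mx_norm_le ?hid1 ?hid2 ?(le_trans (buffer_state_norm _ (uB _))).
Qed.

(** This is the trajectory at the pulse opening period [k.+1]. The receiver is one unit of [k]
    behind, whereas the state of [N1] is not delayed. *)
Lemma compose_relay (R : realType) (d1 d2 d3 m1 m2 n : nat)
    (N1 : rnn R d1 d2 m1) (N2 : rnn R d2 d3 m2) (B1 B Dh : R) x k :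
  0 <= B ->
  (forall x t, `|x| <= B1 -> `|output N1 (impulse x) t| <= B) ->
  (forall x t, `|x| <= B -> `|hidden N2 (impulse x) t| <= Dh) ->
  `|x| <= B1 -> (2 <= k)%N ->
  let h := hidden (compose n N1 N2 B Dh) (impulse x) (2 ^ k.+1 - 2) in
  let u := output N1 (impulse x) (2 ^ k - 2) in
  [/\ usubmx h = hidden N1 (impulse x) (2 ^ k.+1 - 2),
      usubmx (dsubmx h) = hidden N2 (impulse u) (2 ^ k - 2) &
      readout (compose n N1 N2 B Dh) h = output N2 (impulse u) (2 ^ k - 2)].
Proof.
move=> B0 out1 hid2 xB k2 h u.
have k12 : (2 <= k.+1)%N by apply: ltnW.
have k0 : (0 < 2 ^ k.+1)%N by rewrite expn_gt0.
have [_ ho] := clock_pulse R n k12 k0.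
have := compose_hidden n B0 out1 hid2 xB k12 k0.
(* The exceptional first period would require [k = 1]. *)
rewrite /receiver_state ifN; last by rewrite eqSS neq_ltn k2 orbT.
move: ho; rewrite addn0 -/h => ho hE.
by rewrite hE !col_mxKu col_mxKd col_mxKu (compose_readout _ _ _ _ _ _ _ ho) subr0 scale1r.
Qed.

(** * Chains of networks *)

(* [chain N k s x e y]: the maps [g (N l) (k l)], for [s < l <= e], take [x]
   to [y].  As a relation it is free of casts between ['cV_(d (s + n))] and
   ['cV_(d e)]. *)
Inductive chain (R : realType) (d m : nat -> nat)
    (N : forall l : nat, rnn R (d l.-1) (d l) (m l)) (k : nat -> nat) (s : nat)
    (x : 'cV[R]_(d s)) : forall e : nat, 'cV[R]_(d e) -> Prop :=
| chain_nil : chain N k x x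
| chain_step e (y : 'cV[R]_(d e)) :
    chain N k x y -> @chain _ _ _ N k s x e.+1 (g (N e.+1) (k e.+1) y).

Lemma chain_gcomp (R : realType) (d m : nat -> nat)
    (N : forall l : nat, rnn R (d l.-1) (d l) (m l)) k (x : 'cV[R]_(d 0%N))
    e (y : 'cV[R]_(d e)) :
  chain N k x y -> y = gcomp N k e x.
Proof. by elim=> // {}e {}y _ ->. Qed.

Lemma chain_le (R : realType) (d m : nat -> nat)
    (N : forall l : nat, rnn R (d l.-1) (d l) (m l)) k s (x : 'cV[R]_(d s))
    e (y : 'cV[R]_(d e)) :
  chain N k x y -> (s <= e)%N.
Proof. by elim=> // {}e {}y _; apply: leqW. Qed.

Lemma chain_trans (R : realType) (d m : nat -> nat)
    (N : forall l : nat, rnn R (d l.-1) (d l) (m l)) k s (x : 'cV[R]_(d s))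
    e (y : 'cV[R]_(d e)) f (z : 'cV[R]_(d f)) :
  chain N k x y -> chain N k y z -> chain N k x z.
Proof. by move=> xy; elim=> // {}f {}z _; apply: chain_step. Qed.

Lemma eq_chain (R : realType) (d m : nat -> nat)
    (N : forall l : nat, rnn R (d l.-1) (d l) (m l)) k k' s (x : 'cV[R]_(d s))
    e (y : 'cV[R]_(d e)) :
  (forall i, (s < i <= e)%N -> k i = k' i) -> chain N k x y -> chain N k' x y.
Proof.
move=> kk' xy; elim: xy kk' => [_|{}e {}y xy IH kk']; first exact: chain_nil.
rewrite kk'; last by rewrite ltnS (chain_le xy) /=.
apply: chain_step; apply: IH => i /andP[si ie].
by apply: kk'; rewrite si leqW.
Qed.

Definition chain_size (d m : nat -> nat) (L s : nat) : nat :=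
  (\sum_(s.+1 <= l < (s + 2 ^ L).+1) m l + 2 * \sum_(s.+1 <= l < s + 2 ^ L) d l
   + 5 * (2 ^ L - 1))%N.

(** Buffer and clock together have [2 d + 5] neurons for the dimension [d] at the junction, which is
    the term missing from the sums of [d] over the two halves. *)
Lemma chain_sizeS (d m : nat -> nat) (L s : nat) : (0 < d (s + 2 ^ L))%N ->
  (chain_size d m L s +
   (chain_size d m L (s + 2 ^ L) +
    (d (s + 2 ^ L) + (6 + (d (s + 2 ^ L)).-1))))%N = chain_size d m L.+1 s.
Proof.
move=> d0; rewrite /chain_size.
have L0 : (0 < 2 ^ L)%N by rewrite expn_gt0.
have -> : (s + 2 ^ L.+1 = s + 2 ^ L + 2 ^ L)%N by rewrite expnS; lia.
rewrite (@big_cat_nat _ _ _ (s + 2 ^ L).+1 s.+1 (s + 2 ^ L + 2 ^ L).+1) /=; try lia.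
rewrite (@big_cat_nat _ _ _ (s + 2 ^ L) s.+1 (s + 2 ^ L + 2 ^ L)) /=; try lia.
rewrite [X in (_ = _ + 2 * (_ + X) + _)%N]big_ltn; last by lia.
rewrite expnS; lia.
Qed.

(** Induction on [L], with [s] arbitrary so that the hypothesis serves both halves of the chain.
    Stating [e] through an equation avoids casts on [d e]. *)
Lemma chain_network (R : realType) (d m : nat -> nat)
    (N : forall l : nat, rnn R (d l.-1) (d l) (m l)) (Dl : nat -> R) (Dh : R)
    (top : nat) :
  2 <= Dh ->
  (forall l, (l <= top)%N -> (0 < d l)%N) ->
  (forall l, (1 <= l <= top)%N -> 0 <= Dl l <= Dh) ->
  (forall l x t, (1 <= l <= top)%N -> `|x| <= Dl l.-1 ->
     `|output (N l) (impulse x) t| <= Dl l) ->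
  (forall l x t, (1 <= l <= top)%N -> `|x| <= Dl l.-1 ->
     `|hidden (N l) (impulse x) t| <= Dh) ->
  forall L s e, e = (s + 2 ^ L)%N -> (e <= top)%N ->
  exists mhat (Nhat : rnn R (d s) (d e) mhat),
  [/\ mhat = chain_size d m L s,
      forall x t, `|x| <= Dl s ->
        `|output Nhat (impulse x) t| <= Dl e /\ `|hidden Nhat (impulse x) t| <= Dh,
      forall k x, (L + 2 <= k)%N -> `|x| <= Dl s ->
        chain N (fun _ => (k - L)%N) x (output Nhat (impulse x) (2 ^ k - 2)) &
      forall l, (s < l <= e)%N ->
        exists (A : 'M[R]_(d l, mhat)) (b : 'cV[R]_(d l)) (kt : nat -> nat),
        (forall i, (s < i <= l)%N -> (kt i <= up_log 2 (l - s))%N) /\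
        forall k x, (L + 2 <= k)%N -> `|x| <= Dl s ->
          chain N (fun i => (k - kt i)%N) x
            (A *m hidden Nhat (impulse x) (2 ^ k - 2) + b)].
Proof.
move=> D2 d_gt0 DlD outN hidN; elim=> [|L IH] s e.
  rewrite addn1 => -> {e} etop; have etop' : (1 <= s.+1 <= top)%N by [].
  exists (m s.+1), (N s.+1); split.
  - by rewrite /chain_size addn1 big_nat1 big_geq // !muln0 !addn0.
  - by move=> x t xs; split; [apply: outN|apply: hidN].
  - move=> k x _ _; rewrite -[k in (2 ^ k)%N]subn0.
    exact: (chain_step (chain_nil N (fun _ => (k - 0)%N) x)).
  - move=> l /andP[sl ls]; have lE : l = s.+1 by apply/eqP; rewrite eqn_leq ls.
    subst l.
    exists (A_o (N s.+1)), (b_o (N s.+1)), (fun _ => 0%N); split=> // k x _ _.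
    rewrite -[k in (2 ^ k)%N]subn0.
    exact: (chain_step (chain_nil N (fun _ => (k - 0)%N) x)).
move=> eE etop; set c := (s + 2 ^ L)%N.
have L0 : (0 < 2 ^ L)%N by rewrite expn_gt0.
have cE : e = (c + 2 ^ L)%N by rewrite eE /c expnS; lia.
have ctop : (c <= top)%N by lia.
have [m1 [N1 [m1E bd1 all1 some1]]] := IH s c erefl ctop.
have [m2 [N2 [m2E bd2 all2 some2]]] := IH c e cE etop.
have cin : (1 <= c <= top)%N by rewrite ctop andbT /c; lia.
have /andP[Dc0 DcD] := DlD _ cin.
have ein : (1 <= e <= top)%N by rewrite etop andbT; lia.
have /andP[De0 _] := DlD _ ein.
have out1 x t (xs : `|x| <= Dl s) := (bd1 x t xs).1.
have hid1 x t (xs : `|x| <= Dl s) := (bd1 x t xs).2.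
have out2 x t (xs : `|x| <= Dl c) := (bd2 x t xs).1.
have hid2 x t (xs : `|x| <= Dl c) := (bd2 x t xs).2.
exists (m1 + (m2 + (d c + (6 + (d c).-1))))%N, (compose (d c).-1 N1 N2 (Dl c) Dh).
split.
- by rewrite m1E m2E chain_sizeS // d_gt0.
- move=> x t xs.
  by have [] := compose_norm (d c).-1 t Dc0 DcD D2 De0 out1 hid1 out2 hid2 xs.
- move=> [|k] x; rewrite ?addSn // ltnS => Lk xs.
  have k2 : (2 <= k)%N by lia.
  have [_ _] := compose_relay (d c).-1 Dc0 out1 hid2 xs k2.
  rewrite /output => ->; rewrite subSS.
  by apply: chain_trans (all1 k x Lk xs) (all2 k _ Lk _); apply: out1.
- move=> l /andP[sl le]; case: (leqP l c) => lc.
    (* In the first half, [N1] can be read at the undelayed time [2 ^ k.+1 - 2], so the shifts [kt]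
       are unchanged. *)
    have /some1[A [b [kt [ktl AP]]]] : (s < l <= c)%N by rewrite sl.
    exists (row_mx A 0), b, kt; split=> // -[|k] x; rewrite ?addSn // ltnS => Lk xs.
    have k2 : (2 <= k)%N by lia.
    have [hE _ _] := compose_relay (d c).-1 Dc0 out1 hid2 xs k2.
    rewrite -[hidden _ _ _]vsubmxK mul_row_col mul0mx addr0 hE.
    by apply: AP => //; apply: leqW.
  have /some2[A [b [kt [ktl AP]]]] : (c < l <= e)%N by rewrite lc.
  (* In the second half, the input came through the final output of [N1], with shift [L]; the relay
     adds 1 to this and to every later shift. *)
  exists (row_mx 0 (row_mx A 0)), b, (fun i => if (i <= c)%N then L.+1 else (kt i).+1).
  (* Since [l] lies beyond the middle, [l - s] exceeds [2 ^ L]. *)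
  have lup : (L.+1 <= up_log 2 (l - s))%N.
    rewrite ltnNge; apply/negP => /(leq_pexp2l (isT : (0 < 2)%N)).
    have ls1 : (1 < l - s)%N by rewrite /c in lc; lia.
    have := up_logP (l - s) (isT : (1 < 2)%N); rewrite /c in lc; lia.
  split=> [i /andP[si il]|[|k] x]; rewrite ?addSn // ?ltnS.
    case: (leqP i c) => // ci; apply: leq_trans lup; rewrite ltnS.
    (* As [l - c <= 2 ^ L], the shift [kt i] is at most [L]. *)
    apply: leq_trans (ktl i _) _; first by rewrite ci.
    by apply: up_log_min => //; lia.
  move=> Lk xs; have k2 : (2 <= k)%N by lia.
  have [_ hE _] := compose_relay (d c).-1 Dc0 out1 hid2 xs k2.
  rewrite -[hidden _ _ _]vsubmxK mul_row_col mul0mx add0r.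
  rewrite -[dsubmx _]vsubmxK mul_row_col mul0mx addr0 hE.
  apply: (@chain_trans _ _ _ _ _ _ _ c (output N1 (impulse x) (2 ^ k - 2))).
    apply: eq_chain (all1 k x Lk xs) => i /andP[_ ic].
    by rewrite ic subSS.
  apply: eq_chain (AP k _ Lk _) => [i /andP[ci _]|]; last exact: out1.
  by rewrite leqNgt ci subSS.
Qed.

Theorem mainTheorem7 (R : realType) (D : R) (L : nat)
    (d m : nat -> nat) (N : forall l : nat, rnn R (d l.-1) (d l) (m l))
    (Dl : nat -> R) (Dh : R)
    (D_gt0 : 0 < D) (L_gt0 : (0 < L)%N)
    (d_gt0 : forall l : nat, (l <= 2 ^ L)%N -> (0 < d l)%N)
    (m_gt0 : forall l : nat, (1 <= l <= 2 ^ L)%N -> (0 < m l)%N)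
    (Dl_gt0 : forall l : nat, (1 <= l <= 2 ^ L)%N -> 0 < Dl l)
    (Dh_gt0 : 0 < Dh)
    (Dl_le_Dh :
       Num.max 2 (\big[Num.max/0]_(1 <= l < (2 ^ L).+1) Dl l) <= Dh)
    (Dl0 : Dl 0%N = D)
    (output_bound : forall l : nat, (1 <= l <= 2 ^ L)%N ->
       (sup_norm (Dl l.-1) (fun x => output (N l) (impulse x))
          <= (Dl l)%:E)%E)
    (hidden_bound : forall l : nat, (1 <= l <= 2 ^ L)%N ->
       (sup_norm (Dl l.-1) (fun x => hidden (N l) (impulse x))
          <= Dh%:E)%E) :
  exists (mhat : nat) (Nhat : rnn R (d 0%N) (d (2 ^ L)%N) mhat),
    [/\ (sup_norm D (fun x => output Nhat (impulse x))
           <= (Dl (2 ^ L)%N)%:E)%E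
          /\ (sup_norm D (fun x => hidden Nhat (impulse x)) <= Dh%:E)%E,
        forall (k : nat) (x : 'cV[R]_(d 0%N)), (L + 2 <= k)%N ->
          (forall i, x i ord0 \in `[- D, D]) ->
          output Nhat (impulse x) (2 ^ k - 2)
          = gcomp N (fun _ => (k - L)%N) (2 ^ L) x,
        forall l : nat, (1 <= l <= 2 ^ L)%N ->
          exists (A : 'M[R]_(d l, mhat)) (b : 'cV[R]_(d l))
                 (kt : nat -> nat),
            (forall i : nat, (1 <= i <= l)%N -> (kt i <= up_log 2 l)%N) /\
            forall (k : nat) (x : 'cV[R]_(d 0%N)), (L + 2 <= k)%N ->
              (forall i, x i ord0 \in `[- D, D]) ->
              A *m hidden Nhat (impulse x) (2 ^ k - 2) + b
              = gcomp N (fun i => (k - kt i)%N) l x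
      & mhat = (\sum_(1 <= l < (2 ^ L).+1) m l
                + 2 * \sum_(1 <= l < 2 ^ L) d l
                + 5 * (2 ^ L - 1))%N].
Proof.
have DlD l : (1 <= l <= 2 ^ L)%N -> 0 <= Dl l <= Dh.
  move=> lL; rewrite ltW ?Dl_gt0 //=; move: Dl_le_Dh; rewrite ge_max => /andP[_].
  by apply: le_trans; apply: (@le_bigmax_seq _ _ _ _ _ l) => //; rewrite mem_index_iota.
have D2 : 2 <= Dh by move: Dl_le_Dh; rewrite ge_max => /andP[].
have outN l x t : (1 <= l <= 2 ^ L)%N -> `|x| <= Dl l.-1 ->
    `|output (N l) (impulse x) t| <= Dl l.
  by move=> /output_bound/sup_norm_leP; apply.
have hidN l x t : (1 <= l <= 2 ^ L)%N -> `|x| <= Dl l.-1 ->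
    `|hidden (N l) (impulse x) t| <= Dh.
  by move=> /hidden_bound/sup_norm_leP; apply.
have [mhat [Nhat [mE bd all some]]] := chain_network D2 d_gt0 DlD outN hidN
  (esym (add0n (2 ^ L)%N)) (leqnn _).
have xD (x : 'cV[R]_(d 0%N)) : (forall i, x i ord0 \in `[- D, D]) -> `|x| <= Dl 0%N.
  by rewrite Dl0; apply: cV_norm_le_itv; apply: ltW.
exists mhat, Nhat; split.
- by split; apply/sup_norm_leP => x t; rewrite -Dl0 => /(bd _ t)[].
- by move=> k x Lk /xD xs; apply: chain_gcomp; apply: all.
- move=> l /some[A [b [kt [ktl AP]]]]; exists A, b, kt; split.
    by move=> i /ktl; rewrite subn0.
  by move=> k x Lk /xD xs; apply: chain_gcomp; apply: AP.
- by rewrite mE /chain_size add0n.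
Qed.
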